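(* Let $(X,\tau,g)$ be a first countable premetric space. If for every $\varepsilon>0$ and every proper lower semicontinuous and bounded below function $f:X\to\mathbb{R}\cup\{+\infty\}$ there exists $v\in X$ such that $$f(v)\le f(x)+\varepsilon g(x,v)\quad\text{for all }x\in X,$$ then $(X,\tau,g)$ is $\Sigma_g$-semicomplete.
   Context: $\mathbb{R}^+=[0,\infty)$. A premetric space $(X,\tau,g)$ is a first countable topological space $(X,\tau)$ with a premetric function $g:X\times X\to\mathbb{R}^+$, i.e. (P1) $g(x,x)=0$ for all $x\in X$ and $g(x,y)>0$ whenever $x\neq y$; (P2) $g(x,\cdot)$ is continuous for every fixed $x\in X$. (No symmetry or triangle inequality is assumed.) A sequence $\{x_n\}_{n\ge0}$ in $X$ is $\Sigma_g$-Cauchy if its $g$-length $\sum_{i=0}^\infty g(x_{i+1},x_i)$ is finite. $(X,\tau,g)$ is called $\Sigma_g$-semicomplete if every $\Sigma_g$-Cauchy sequence in $X$ has a convergent subsequence. Proper means $f$ is not identically $+\infty$. *)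

(* Defs.v *)
From HB Require Import structures.
From mathcomp Require Import all_boot all_order all_algebra.
From mathcomp Require Import all_classical all_reals all_analysis.

Set Implicit Arguments.
Unset Strict Implicit.
Unset Printing Implicit Defensive.

Import Order.TTheory GRing.Theory Num.Theory.
Import numFieldNormedType.Exports.

Local Open Scope classical_set_scope.
Local Open Scope ring_scope.

Definition first_countable (X : topologicalType) : Prop :=
  forall x : X, exists B : set (set X),
    [/\ countable B, B `<=` nbhs x &
        forall U, nbhs x U -> exists2 V, B V & V `<=` U].

(* Neither symmetry nor the triangle inequality is required. *)
Definition premetric (R : realType) (X : topologicalType) (g : X -> X -> R) :
    Prop :=
  [/\ forall x y, 0 <= g x y,
      forall x, g x x = 0,
      forall x y, x <> y -> 0 < g x y &
      forall x, continuous (g x)].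

Definition premetric_space (R : realType) (X : topologicalType)
    (g : X -> X -> R) : Prop :=
  first_countable X /\ premetric g.

Definition g_length (R : realType) (X : topologicalType) (g : X -> X -> R)
    (x : nat -> X) : \bar R :=
  (\sum_(0 <= i <oo) (g (x i.+1) (x i))%:E)%E.

Definition Sigma_Cauchy (R : realType) (X : topologicalType)
    (g : X -> X -> R) (x : nat -> X) : Prop :=
  (g_length g x < +oo)%E.

(* The limit is quantified explicitly because [cvgn] is only available on
   pointed spaces, whereas X may be empty here. *)
Definition has_convergent_subsequence (X : topologicalType) (x : nat -> X) :
    Prop :=
  exists s : nat -> nat,
    increasing_seq s /\ exists l : X, x \o s @ \oo --> l.

Definition Sigma_semicomplete (R : realType) (X : topologicalType)
    (g : X -> X -> R) : Prop :=
  forall x : nat -> X, Sigma_Cauchy g x -> has_convergent_subsequence x.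

(* [f] ranges over functions into \bar R; the value -oo is excluded
   separately, so that the codomain is R with +oo adjoined. *)
Definition no_ninfty (R : realType) (X : Type) (f : X -> \bar R) : Prop :=
  forall x, f x <> -oo%E.

Definition proper_fun (R : realType) (X : Type) (f : X -> \bar R) : Prop :=
  exists x, f x <> +oo%E.

Definition bounded_below (R : realType) (X : Type) (f : X -> \bar R) : Prop :=
  exists m : R, forall x, (m%:E <= f x)%E.

(* Main.v *)
(** Suppose a [Sigma_g]-Cauchy sequence [x] has no convergent subsequence.  By
    first countability it has no cluster point, so every point has a
    neighborhood meeting the range of [x] at most in that point (the range is
    discrete and closed since [g] separates points).  Let
    [T n = \sum_(i >= n) g (x (i+1)) (x i)] and let [f] be [T n] at [x n], the
    smallest value if [x] repeats, and [+oo] off the range.  Then [f] is lower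
    semicontinuous, and a point [v] with [f v <= f y + g y v / 2] for all [y]
    would be [x n] for a last index [n]; testing [y = x (n+1) <> v] gives
    [g (x (n+1)) (x n) <= g (x (n+1)) (x n) / 2], which is absurd. *)

Require Import Defs.
From mathcomp Require Import all_boot all_order all_algebra.
From mathcomp Require Import all_classical all_reals all_analysis.

Import Order.TTheory GRing.Theory Num.Theory.
Import numFieldNormedType.Exports.

Local Open Scope classical_set_scope.
Local Open Scope ring_scope.

Set Implicit Arguments.
Unset Strict Implicit.

(** Enumerating a countable base at [l] and intersecting its first members gives decreasing
    neighborhoods [V k], each visited by [x] at arbitrarily late indices. *)
Lemma first_countable_cluster_subsequence (X : topologicalType) (x : nat -> X)
    (l : X) :
  first_countable X -> cluster (x @ \oo) l -> has_convergent_subsequence x.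
Proof.
move=> /(_ l)[B [cB Bl Bbase]] xl.
have [f fl fbase] : exists2 f : nat -> set X, (forall n, nbhs l (f n)) &
    forall U, nbhs l U -> exists n, f n `<=` U.
  move/pfcard_geP : cB => [B0|/unsquash f].
    by have [V] := Bbase _ filterT; rewrite B0.
  exists f => [n|U /Bbase[V + VU]]; first by apply: Bl; exact: funS.
  by move=> /(@surj _ _ _ _ f)[n _ fn]; exists n; rewrite fn.
pose V k := [set y | forall i : 'I_k.+1, f i y].
have Vl k : nbhs l (V k) by apply: filter_forall => i; exact: fl.
have /choice[p pP] : forall kn : nat * nat, exists m,
    (kn.2 <= m)%N /\ V kn.1 (x m).
  move=> [k n].
  have [|y [[m nm <-] Vm]] := xl (x @` [set m | (n <= m)%N]) _ _ (Vl k).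
    by exists n => // m nm; exists m.
  by exists m.
(* Each index is sought from [(s k').+1] on, which makes [s] strictly increasing. *)
pose s := fix s k := if k is k'.+1 then p (k, (s k').+1) else p (0, 0)%N.
have Vs k : V k (x (s k)).
  by case: k => [|k]; [have [] := pP (0, 0)%N|have [] := pP (k.+1, (s k).+1)].
exists s; split.
  by apply/increasing_seqP => n; have [] := pP (n.+1, (s n).+1).
exists l => U /fbase[n fU]; exists n => // k nk; apply: fU.
by have := Vs k (Ordinal (nk : (n < k.+1)%N)).
Qed.

(** [g z] is positive at [y], hence near [y] by continuity, but vanishes at [z]. *)
Lemma premetric_nbhs_neq (R : realType) (X : topologicalType) (g : X -> X -> R)
    (y z : X) :
  premetric g -> z <> y -> \forall t \near y, t <> z.
Proof.
move=> [_ g0 gpos gcont] zy.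
have : \forall t \near y, 0 < g z t.
  exact: (gcont z y _ (lt_nbhsr (gpos _ _ zy))).
by apply: filterS => t + tz; rewrite tz g0 ltxx.
Qed.

(** Some neighborhood of [y] misses all terms from an index [N] on; the finitely many earlier terms
    other than [y] are then excluded one at a time. *)
Lemma premetric_nbhs_avoid (R : realType) (X : topologicalType)
    (g : X -> X -> R) (x : nat -> X) (y : X) :
  premetric g -> ~ cluster (x @ \oo) y ->
  \forall t \near y, forall n, x n = t -> t = y.
Proof.
move=> pg ncl.
have [A [B [[N _ NA] By AB]]] : exists A B,
    [/\ (x @ \oo) A, nbhs y B & ~ ((A `&` B) !=set0)].
  apply: contrapT => h; apply: ncl => A B xA yB.
  by apply: contrapT => AB; apply: h; exists A, B.
have near_fin : \forall t \near y, forall i : 'I_N, x i = t -> t = y.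
  apply: filter_forall => i; have [->|/eqP xiy] := eqVneq (x i) y.
    by apply: nearW => t <-.
  by apply: filterS (premetric_nbhs_neq pg xiy) => t + xit; rewrite xit.
apply: filterS2 near_fin By => t tN Bt n xnt.
have [nN|Nn] := ltnP n N; first exact: (tN (Ordinal nN)).
by exfalso; apply: AB; exists t; split=> //; rewrite -xnt; exact: NA.
Qed.

Lemma finite_fiber_of_not_cluster (X : topologicalType) (x : nat -> X) (y : X) :
  ~ cluster (x @ \oo) y -> exists N, forall n, x n = y -> (n < N)%N.
Proof.
move=> ncl; apply: contrapT => h; apply: ncl => A B [N _ NA] yB.
have [n [xny Nn]] : exists n, x n = y /\ (N <= n)%N.
  apply: contrapT => k; apply: h; exists N => n xny.
  by rewrite ltnNge; apply/negP => Nn; apply: k; exists n.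
by exists y; split; [rewrite -xny; exact: NA|exact: nbhs_singleton].
Qed.

Section tail_infimum.
Context (R : realType) (X : topologicalType) (T : nat -> \bar R) (x : nat -> X).

Definition inf_on_sequence (y : X) : \bar R :=
  ereal_inf [set T n | n in x @^-1` [set y]].

Lemma inf_on_sequence_le n : (inf_on_sequence (x n) <= T n)%E.
Proof. by apply: ereal_inf_lbound; exists n. Qed.

Lemma inf_on_sequence_ge (m : \bar R) y :
  (forall n, m <= T n)%E -> (m <= inf_on_sequence y)%E.
Proof. by move=> mT; apply/ereal_infP => _ [n _ <-]. Qed.

Lemma inf_on_sequence_off y : (forall n, x n <> y) -> inf_on_sequence y = +oo%E.
Proof.
move=> xy; rewrite /inf_on_sequence (_ : [set _ | _ in _] = set0) ?ereal_inf0//.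
by apply/seteqP; split => // t [n /xy].
Qed.

(** Near [y] the only possible term of the sequence is [y] itself; at every other point the value is
    [+oo]. *)
Lemma lower_semicontinuous_inf_on_sequence (g : X -> X -> R) :
  premetric g -> (forall y, ~ cluster (x @ \oo) y) ->
  lower_semicontinuous inf_on_sequence.
Proof.
move=> pg ncl y a ay.
have near_y := premetric_nbhs_avoid pg (ncl y).
exists [set t | forall n, x n = t -> t = y] => //= t ty.
have [[n xnt]|xt] := pselect (exists n, x n = t); first by rewrite (ty _ xnt).
by rewrite inf_on_sequence_off ?ltry// => n xnt; apply: xt; exists n.
Qed.

(** The fiber over [y] is nonempty and bounded; as [T] is nonincreasing, its last index realizes the
    infimum. *)
Lemma inf_on_sequence_attained y :
  (forall n, (T n.+1 <= T n)%E) -> ~ cluster (x @ \oo) y ->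
  (inf_on_sequence y < +oo)%E ->
  exists n, [/\ x n = y, inf_on_sequence y = T n & x n.+1 <> y].
Proof.
move=> Tdec ncl fy.
have [n0 xn0] : exists n, x n = y.
  apply: contrapT => xy; move: fy; rewrite inf_on_sequence_off ?ltxx//.
  by move=> n xny; apply: xy; exists n.
have [N xN] := finite_fiber_of_not_cluster ncl.
have exP : exists n, `[< x n = y >] by exists n0; apply/asboolP.
have ubP n : `[< x n = y >] -> (n <= N)%N by move=> /asboolP/xN/ltnW.
case: (ex_maxnP exP ubP) => n /asboolP xny nmax; exists n; split=> //.
  apply/eqP; rewrite eq_le -{1}xny inf_on_sequence_le/=.
  apply/ereal_infP => _ [m xmy <-].
  by have /nonincreasing_seqP := Tdec; apply; apply: nmax; apply/asboolP.
by move=> /asboolP/nmax; rewrite ltnn.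
Qed.

End tail_infimum.

Unset Implicit Arguments.

Theorem theorem3p10 (R : realType) (X : topologicalType) (g : X -> X -> R)
    (Xg : premetric_space g)
    (H : forall eps : R, 0 < eps ->
         forall f : X -> \bar R,
           no_ninfty f -> proper_fun f -> lower_semicontinuous f ->
           bounded_below f ->
           exists v : X, forall x : X, (f v <= f x + (eps * g x v)%:E)%E) :
  Sigma_semicomplete g.
Proof.
case: Xg => fcX pg x xg; apply: contrapT => nosub.
have ncl y : ~ cluster (x @ \oo) y.
  by move=> /(first_countable_cluster_subsequence fcX).
have [g0 _ gpos _] := pg.
pose T n : \bar R := (\sum_(n <= i <oo) (g (x i.+1) (x i))%:E)%E.
have T0 n : (0 <= T n)%E by apply: nneseries_ge0 => i _ _; rewrite lee_fin.
have TS n : T n = ((g (x n.+1) (x n))%:E + T n.+1)%E.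
  rewrite /T (@nneseries_split _ _ n 1) ?addn1 ?big_nat1// => i _.
  by rewrite lee_fin.
have Tdec n : (T n.+1 <= T n)%E by rewrite (TS n) leeDr// lee_fin.
have Toc n : (T n < +oo)%E.
  (* [T 0] is the [g]-length of [x], finite by assumption. *)
  by elim: n => // n; exact: le_lt_trans.
pose f := inf_on_sequence T x.
have f0 y : (0 <= f y)%E by exact: inf_on_sequence_ge.
have fx n : (f (x n) < +oo)%E := le_lt_trans (inf_on_sequence_le _ _ _) (Toc n).
(* Any constant strictly between 0 and 1 would serve as well as [2^-1]. *)
have [|||||v vP] := H 2^-1 _ f; rewrite ?invr_gt0//.
- by move=> y fy; have := f0 y; rewrite fy.
- by exists (x 0%N) => fy; have := fx 0%N; rewrite fy ltxx.
- exact: lower_semicontinuous_inf_on_sequence pg ncl.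
- by exists 0.
have fv : (f v < +oo)%E.
  by apply: le_lt_trans (vP (x 0%N)) _; rewrite lte_add_pinfty ?ltry.
have [n [xnv fvn xSv]] := inf_on_sequence_attained Tdec (ncl v) fv.
have := vP (x n.+1); rewrite -/f in fvn; rewrite fvn (TS n) xnv leNgt => /negP; apply.
rewrite [ltRHS]addeC; apply: (@le_lt_trans _ _ (T n.+1 + (2^-1 * g (x n.+1) v)%:E)%E).
  by apply: leeD2r; exact: inf_on_sequence_le.
(* [T n.+1] is finite, so it cancels; [xSv] makes the remaining distance positive, hence larger than
   its half. *)
rewrite lteD2lE ?ge0_fin_numE// lte_fin gtr_pMl ?gpos//.
by rewrite invf_lt1// ltr1n.
Qed.
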